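(* For every cograph $G$, the following are equivalent: (1) $G$ is $1$-perfectly orientable; (2) $G$ is $K_{2,3}$-free; (3) one of the following holds: $G\cong K_1$; $G\cong\overline{mK_2}$ for some $m\ge 2$; $G$ is the disjoint union of two smaller $1$-perfectly orientable cographs; $G$ is obtained from a $1$-perfectly orientable cograph by adding a universal vertex; $G$ is obtained from a $1$-perfectly orientable cograph by adding a true twin.
   Context: All graphs are finite and simple. Cographs are defined recursively: $K_1$ is a cograph, disjoint unions and joins of two cographs are cographs, and there are no others (equivalently, cographs are the $P_4$-free graphs). $G$ is $H$-free if no induced subgraph of $G$ is isomorphic to $H$. $mK_2$ is the disjoint union of $m$ copies of $K_2$, and $\overline{mK_2}$ its complement. An orientation of a graph $G$ is $1$-perfect if for every vertex $v$, its out-neighborhood is a clique in $G$; $G$ is $1$-perfectly orientable if it admits a $1$-perfect orientation. A universal vertex is adjacent to all other vertices; adding a true twin of a vertex $w$ means adding a new vertex $v$ adjacent to $w$ and to all neighbors of $w$, and to nothing else. *)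

(* Defs.v *)
From mathcomp Require Import all_boot.

Set Implicit Arguments.
Unset Strict Implicit.
Unset Printing Implicit Defensive.

Record sgraph := SGraph {
  vertex :> finType;
  edge : rel vertex;
  edge_sym : symmetric edge;
  edge_irrefl : irreflexive edge }.

Arguments edge {G} : rename.

Definition giso (G H : sgraph) : Prop :=
  exists2 f : G -> H, bijective f & {mono f : x y / edge x y}.

Section InducedSubgraph.
Variables (G : sgraph) (A : {set G}).

Definition induced_edge : rel {x : G | x \in A} := relpre val edge.

Lemma induced_edge_sym : symmetric induced_edge.
Proof. by move=> x y; apply: edge_sym. Qed.

Lemma induced_edge_irrefl : irreflexive induced_edge.
Proof. by move=> x; apply: edge_irrefl. Qed.

Definition induced : sgraph := SGraph induced_edge_sym induced_edge_irrefl.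
End InducedSubgraph.

Definition free_of (H G : sgraph) : Prop :=
  forall A : {set G}, ~ giso (induced A) H.

Section Complement.
Variable G : sgraph.

Definition compl_edge : rel G := fun x y => (x != y) && ~~ edge x y.

Lemma compl_edge_sym : symmetric compl_edge.
Proof. by move=> x y; rewrite /compl_edge eq_sym edge_sym. Qed.

Lemma compl_edge_irrefl : irreflexive compl_edge.
Proof. by move=> x; rewrite /compl_edge eqxx. Qed.

Definition compl : sgraph := SGraph compl_edge_sym compl_edge_irrefl.
End Complement.

Section UnionJoin.
Variables G H : sgraph.

Definition dunion_edge : rel (G + H)%type := fun u v =>
  match u, v with
  | inl x, inl y => edge x y
  | inr x, inr y => edge x y
  | _, _ => false
  end.

Lemma dunion_edge_sym : symmetric dunion_edge.
Proof. by move=> [x|x] [y|y] //=; apply: edge_sym. Qed.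

Lemma dunion_edge_irrefl : irreflexive dunion_edge.
Proof. by move=> [x|x] /=; apply: edge_irrefl. Qed.

Definition dunion : sgraph := SGraph dunion_edge_sym dunion_edge_irrefl.

Definition join_edge : rel (G + H)%type := fun u v =>
  match u, v with
  | inl x, inl y => edge x y
  | inr x, inr y => edge x y
  | _, _ => true
  end.

Lemma join_edge_sym : symmetric join_edge.
Proof. by move=> [x|x] [y|y] //=; apply: edge_sym. Qed.

Lemma join_edge_irrefl : irreflexive join_edge.
Proof. by move=> [x|x] /=; apply: edge_irrefl. Qed.

Definition join : sgraph := SGraph join_edge_sym join_edge_irrefl.
End UnionJoin.

Section Complete.
Variable n : nat.

Definition complete_edge : rel 'I_n := fun i j => i != j.

Lemma complete_edge_sym : symmetric complete_edge.
Proof. by move=> i j; apply: (congr1 negb); apply: eq_sym. Qed.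

Lemma complete_edge_irrefl : irreflexive complete_edge.
Proof. by move=> i; rewrite /complete_edge eqxx. Qed.

Definition complete : sgraph := SGraph complete_edge_sym complete_edge_irrefl.
End Complete.

Section CompleteBipartite.
Variables m n : nat.

Definition bipartite_edge : rel ('I_m + 'I_n)%type := fun u v =>
  match u, v with
  | inl _, inr _ | inr _, inl _ => true
  | _, _ => false
  end.

Lemma bipartite_edge_sym : symmetric bipartite_edge.
Proof. by move=> [i|i] [j|j]. Qed.

Lemma bipartite_edge_irrefl : irreflexive bipartite_edge.
Proof. by move=> [i|i]. Qed.

Definition complete_bipartite : sgraph :=
  SGraph bipartite_edge_sym bipartite_edge_irrefl.
End CompleteBipartite.

Section Copies.
Variables (m : nat) (G : sgraph).

Definition copies_edge : rel ('I_m * G)%type :=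
  fun u v => (u.1 == v.1) && edge u.2 v.2.

Lemma copies_edge_sym : symmetric copies_edge.
Proof. by move=> u v; rewrite /copies_edge eq_sym edge_sym. Qed.

Lemma copies_edge_irrefl : irreflexive copies_edge.
Proof. by move=> u; rewrite /copies_edge edge_irrefl andbF. Qed.

Definition copies : sgraph := SGraph copies_edge_sym copies_edge_irrefl.
End Copies.

Section AddUniversal.
Variable G : sgraph.

Definition universal_edge : rel (option G) := fun u v =>
  match u, v with
  | Some x, Some y => edge x y
  | None, None => false
  | _, _ => true
  end.

Lemma universal_edge_sym : symmetric universal_edge.
Proof. by move=> [x|] [y|] //=; apply: edge_sym. Qed.

Lemma universal_edge_irrefl : irreflexive universal_edge.
Proof. by move=> [x|] //=; apply: edge_irrefl. Qed.

Definition add_universal : sgraph :=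
  SGraph universal_edge_sym universal_edge_irrefl.
End AddUniversal.

Section AddTrueTwin.
Variables (G : sgraph) (w : G).

Definition twin_edge : rel (option G) := fun u v =>
  match u, v with
  | Some x, Some y => edge x y
  | None, None => false
  | Some x, None | None, Some x => (x == w) || edge w x
  end.

Lemma twin_edge_sym : symmetric twin_edge.
Proof. by move=> [x|] [y|] //=; apply: edge_sym. Qed.

Lemma twin_edge_irrefl : irreflexive twin_edge.
Proof. by move=> [x|] //=; apply: edge_irrefl. Qed.

(* The vertex None is the new true twin of w. *)
Definition add_true_twin : sgraph := SGraph twin_edge_sym twin_edge_irrefl.
End AddTrueTwin.

(* Isomorphism is built into each clause because graphs are considered up to
   isomorphism; the null graph is not a cograph. *)
Inductive cograph : sgraph -> Prop :=
| cograph_K1 (G : sgraph) : giso G (complete 1) -> cograph G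
| cograph_dunion (G G1 G2 : sgraph) :
    cograph G1 -> cograph G2 -> giso G (dunion G1 G2) -> cograph G
| cograph_join (G G1 G2 : sgraph) :
    cograph G1 -> cograph G2 -> giso G (join G1 G2) -> cograph G.

Section Orientation.
Variable G : sgraph.

Definition clique (A : {set G}) : Prop :=
  {in A &, forall x y, x != y -> edge x y}.

Definition orientation (arc : rel G) : Prop :=
  (forall x y, arc x y -> edge x y) /\
  (forall x y, edge x y -> arc x y (+) arc y x).

Definition out_nbhd (arc : rel G) (v : G) : {set G} := [set x | arc v x].

Definition one_perfect_orientation (arc : rel G) : Prop :=
  orientation arc /\ forall v, clique (out_nbhd arc v).

Definition one_perfectly_orientable : Prop :=
  exists arc : rel G, one_perfect_orientation arc.
End Orientation.

(* Main.v *)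
Require Import Defs.
From mathcomp Require Import all_boot.

(* Orienting towards a new universal vertex, or giving a true twin the same in-
   and out-neighbours as the original, preserves 1-perfection. Conversely let G
   be a K_{2,3}-free cograph without universal vertices and true twins. If G is
   a join, each side contains two non-adjacent vertices, so the other side has
   no independent triple. A cograph with these properties is by induction either
   two isolated vertices or a join of such cographs, hence the complement of a
   perfect matching. *)

Set Implicit Arguments.
Unset Strict Implicit.
Unset Printing Implicit Defensive.

(** * Induced embeddings, isomorphisms and vertex cuts *)

Definition embeds (H G : sgraph) : Prop :=
  exists2 f : H -> G, injective f & {mono f : x y / edge x y}.

Lemma embeds_trans (G H K : sgraph) : embeds G H -> embeds H K -> embeds G K.
Proof.
move=> [f fI fE] [g gI gE]; exists (g \o f); first exact: inj_comp.
by move=> x y /=; rewrite gE fE.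
Qed.

Lemma giso_embeds (G H : sgraph) : giso G H -> embeds G H.
Proof. by case=> f /bij_inj fI fE; exists f. Qed.

Lemma giso_sym (G H : sgraph) : giso G H -> giso H G.
Proof.
move=> [f [g fK gK] fE]; exists g; first by exists f.
by move=> x y; rewrite -fE !gK.
Qed.

Lemma giso_trans (G H K : sgraph) : giso G H -> giso H K -> giso G K.
Proof.
move=> [f fB fE] [g gB gE]; exists (g \o f); first exact: bij_comp.
by move=> x y /=; rewrite gE fE.
Qed.

Lemma giso_card (G H : sgraph) : giso G H -> #|G| = #|H|.
Proof. by case=> f /bij_eq_card. Qed.

(** An injection into a set that is not larger is bijective, so isomorphisms can be given by one
    explicit map without its inverse. *)
Lemma giso_card_leq (G H : sgraph) (f : G -> H) :
  injective f -> #|H| <= #|G| -> {mono f : x y / edge x y} -> giso G H.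
Proof. by move=> fI le_HG fE; exists f => //; apply: inj_card_bij. Qed.

Lemma embeds_induced (G : sgraph) (A : {set G}) : embeds (induced A) G.
Proof. by exists val => //; apply: val_inj. Qed.

Lemma card_induced (G : sgraph) (A : {set G}) : #|induced A| = #|A|.
Proof. exact: card_sig. Qed.

(** The image of an embedding, taken as a vertex set, induces a copy of [H]. This trades the subsets
    in [free_of] for maps, which compose. *)
Lemma free_ofP (H G : sgraph) : free_of H G <-> ~ embeds H G.
Proof.
split=> [freeG [f fI fE]|nHG A isoA]; last first.
  apply: nHG; apply: embeds_trans (embeds_induced A).
  exact/giso_embeds/giso_sym.
apply: (freeG [set f x | x : H]); apply: giso_sym.
pose g x : induced [set f x | x : H] := Sub (f x) (imset_f f (isT : x \in H)).
apply: (@giso_card_leq _ _ g) => [x y /(congr1 val)||x y]; first exact: fI.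
  by rewrite card_induced card_imset.
exact: fE.
Qed.

(** The boolean [c] tells whether all or none of the edges across the cut are present, so that joins
    and disjoint unions share one argument. *)
Lemma giso_sum_induced (c : bool) (G : sgraph) (A : {set G}) :
  (forall x y, x \in A -> y \notin A -> edge x y = c) ->
  giso G (if c then join (induced A) (induced (~: A))
          else dunion (induced A) (induced (~: A))).
Proof.
move=> edgeA; apply: giso_sym.
pose f (u : (induced A + induced (~: A))%type) : G :=
  match u with inl x => sval x | inr x => sval x end.
have inA (x : induced A) : sval x \in A by apply: (valP x).
have notA (x : induced (~: A)) : sval x \notin A by rewrite -in_setC (valP x).
have fI : injective f.
  move=> [x|x] [y|y] /= eq_xy.
  - by congr inl; apply: val_inj.
  - by have := notA y; rewrite -eq_xy inA.
  - by have := notA x; rewrite eq_xy inA.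
  - by congr inr; apply: val_inj.
have cardf : #|G| <= #|{: induced A + induced (~: A)}|.
  by rewrite card_sum !card_induced cardsC.
have fE x y : edge (f (inl x)) (f (inr y)) = c by rewrite edgeA //= ?inA ?notA.
case: c {edgeA} fE => fE.
  apply: (@giso_card_leq (join _ _) G f) => // -[x|x] [y|y];
    by [|exact: fE|rewrite edge_sym; apply: fE].
apply: (@giso_card_leq (dunion _ _) G f) => // -[x|x] [y|y];
  by [|exact: fE|rewrite edge_sym; apply: fE].
Qed.

(** [A] is the preimage of the left summand and its complement that of the right one. Either may be
    empty. *)
Lemma embeds_sum_split (c : bool) (H G1 G2 : sgraph) :
  embeds H (if c then join G1 G2 else dunion G1 G2) ->
  exists2 A : {set H}, embeds (induced A) G1 /\ embeds (induced (~: A)) G2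
    & forall x y, x \in A -> y \notin A -> edge x y = c.
Proof.
(* Both values of [c] are first brought to one formula, in which pairs from different summands get
   the value [c]. *)
move=> HG; have [f fI fE] : exists2 f : H -> G1 + G2, injective f
  & forall x y, edge x y = match f x, f y with
                           | inl x, inl y => edge x y
                           | inr x, inr y => edge x y
                           | _, _ => c
                           end.
  by case: c HG => -[f fI fE]; exists f => // x y; rewrite -fE /=;
    case: (f x) (f y) => ? [].
exists [set x | if f x is inl _ then true else false]; last first.
  by move=> x y; rewrite !inE fE; case: (f x) => // x' _; case: (f y).
split.
- have ex (x : induced [set x | if f x is inl _ then true else false]) :
      {y | f (sval x) = inl y}.
    by have := valP x; rewrite inE /=; case: (f _) => // y _; exists y.
  exists (fun x => sval (ex x)) => [x y /= eq_xy|x y].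
    by apply/val_inj/fI; rewrite /= (svalP (ex x)) (svalP (ex y)) eq_xy.
  by rewrite /= /induced_edge /= fE; case: (ex x) (ex y) => [x' /= ->] [y' /= ->].
- have ex (x : induced (~: [set x | if f x is inl _ then true else false])) :
      {y | f (sval x) = inr y}.
    by have := valP x; rewrite !inE /=; case: (f _) => // y _; exists y.
  exists (fun x => sval (ex x)) => [x y /= eq_xy|x y].
    by apply/val_inj/fI; rewrite /= (svalP (ex x)) (svalP (ex y)) eq_xy.
  by rewrite /= /induced_edge /= fE; case: (ex x) (ex y) => [x' /= ->] [y' /= ->].
Qed.

Lemma giso_card1 (G H : sgraph) : #|G| = 1 -> #|H| = 1 -> giso G H.
Proof.
move=> G1 H1; have /fintype1P[y0 Hy] : #|H| == 1 by rewrite H1.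
have /fintype_le1P Gx : #|G| <= 1 by rewrite G1.
apply: (@giso_card_leq _ _ (fun _ => y0)) => [x y _||x y]; first exact: Gx.
  by rewrite G1 H1.
by rewrite (Gx y x) !edge_irrefl.
Qed.

Lemma card_complete n : #|complete n| = n.
Proof. exact: card_ord. Qed.

(** * Nonempty induced subgraphs of cographs *)

Lemma cograph_card_gt0 (G : sgraph) : cograph G -> 0 < #|G|.
Proof.
elim=> {G} [G /giso_card->|G G1 G2 _ G1_gt0 _ _ /giso_card->|
  G G1 G2 _ G1_gt0 _ _ /giso_card->]; rewrite ?card_complete //;
  by rewrite card_sum addn_gt0 G1_gt0.
Qed.

Lemma embeds_induced_set0 (G H : sgraph) (A : {set G}) :
  A = set0 -> embeds (induced (~: A)) H -> embeds G H.
Proof.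
move=> -> [f fI fE]; have inT (x : G) : x \in ~: set0 by rewrite !inE.
exists (fun x => f (Sub x (inT x))) => [x y /fI[]//|x y].
by rewrite fE.
Qed.

Lemma embeds_inducedC_set0 (G H : sgraph) (A : {set G}) :
  ~: A = set0 -> embeds (induced A) H -> embeds G H.
Proof. by move=> A0 AH; apply: (embeds_induced_set0 A0); rewrite setCK. Qed.

(** By induction on the construction of [G]: [H] is cut along the two summands. If one of them is
    missed, [H] embeds in the other; if not, [H] is a sum of the same kind of two nonempty graphs
    that are cographs by induction. *)
Lemma cograph_embeds (G H : sgraph) :
  cograph G -> embeds H G -> 0 < #|H| -> cograph H.
Proof.
have step c (G0 G1 G2 H0 : sgraph) :
    (forall K, embeds K G1 -> 0 < #|K| -> cograph K) ->
    (forall K, embeds K G2 -> 0 < #|K| -> cograph K) ->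
    giso G0 (if c then join G1 G2 else dunion G1 G2) ->
    embeds H0 G0 -> 0 < #|H0| -> cograph H0.
  move=> IH1 IH2 /giso_embeds isoG HG H_gt0.
  have [A [A1 A2] /giso_sum_induced isoH] :=
    embeds_sum_split (embeds_trans HG isoG).
  have [A0|A_gt0] := set_0Vmem A.
    exact: IH2 (embeds_induced_set0 A0 A2) H_gt0.
  have [B0|B_gt0] := set_0Vmem (~: A).
    exact: IH1 (embeds_inducedC_set0 B0 A1) H_gt0.
  have cA : cograph (induced A).
    by apply: IH1 => //; rewrite card_induced; case: A_gt0 => x Ax;
      apply/card_gt0P; exists x.
  have cB : cograph (induced (~: A)).
    by apply: IH2 => //; rewrite card_induced; case: B_gt0 => x Bx;
      apply/card_gt0P; exists x.
  case: c isoG isoH => _ isoH; first exact: cograph_join isoH.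
  exact: cograph_dunion isoH.
move=> cG; elim: cG H => {G} [G isoG H HG H_gt0|
  G G1 G2 _ IH1 _ IH2 isoG H|G G1 G2 _ IH1 _ IH2 isoG H].
- have [f fI _] := embeds_trans HG (giso_embeds isoG).
  apply: cograph_K1; apply: giso_card1; last exact: card_complete.
  apply/eqP; rewrite eqn_leq H_gt0 andbT -(card_complete 1).
  exact: leq_card fI.
- exact: (step false G G1 G2 H IH1 IH2 isoG).
- exact: (step true G G1 G2 H IH1 IH2 isoG).
Qed.

(** * One-perfect orientations *)

Lemma orientable_embeds (G H : sgraph) :
  embeds H G -> one_perfectly_orientable G -> one_perfectly_orientable H.
Proof.
move=> [f fI fE] [arc [[arcE arcX] arcC]]; exists (fun x y => arc (f x) (f y)).
split; first by split=> x y; rewrite -fE; [apply: arcE | apply: arcX].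
move=> v x y; rewrite !inE -fE -(inj_eq fI) => vx vy.
by apply: arcC; rewrite inE; [exact: vx | exact: vy].
Qed.

(** Each of the three vertices [b j] receives an arc from some [a i], since otherwise it would point
    to both [a i], which are non-adjacent. By the pigeonhole principle two of them receive an arc
    from the same [a i], whose out-neighbourhood is then not a clique. *)
Lemma K23_not_orientable :
  ~ one_perfectly_orientable (complete_bipartite 2 3).
Proof.
case=> arc [[arcE arcX] arcC].
pose a i : complete_bipartite 2 3 := inl i.
pose b j : complete_bipartite 2 3 := inr j.
have ex j : exists i, arc (a i) (b j).
  apply/existsP; rewrite -[X in is_true X]negbK negb_exists; apply/negP => /forallP no.
  have ba i : arc (b j) (a i).
    by have := arcX (a i) (b j) isT; rewrite (negbTE (no i)).
  have := arcC (b j) (a ord0) (a ord_max).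
  by rewrite !inE !ba => /(_ isT isT isT).
pose g j := xchoose (ex j).
have /injectivePn[j [j' neq_j eq_g]] : ~~ injectiveb g.
  by apply/negP => /injectiveP/leq_card; rewrite !card_ord.
have := arcC (a (g j)) (b j) (b j'); rewrite !inE (xchooseP (ex j)).
rewrite [in X in _ -> X -> _]eq_g (xchooseP (ex j')) => /(_ isT isT).
by rewrite (inj_eq (@inr_inj _ _)) neq_j => /(_ isT).
Qed.

Lemma orientable_K1 : one_perfectly_orientable (complete 1).
Proof.
exists (fun _ _ => false); split; last by move=> v x y; rewrite inE.
by split=> // x y /=; rewrite /complete_edge !ord1.
Qed.

(** This is the cocktail party graph: complete multipartite with all parts of size two, the first
    component naming the part. *)
Lemma edge_cocktail m (u v : compl (copies m (complete 2))) :
  edge u v = (u.1 != v.1).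
Proof.
rewrite /= /compl_edge /= /copies_edge /= /complete_edge.
case: u v => [i c] [j d] /=; rewrite xpair_eqE.
by case: (i == j) => //=; rewrite ?negbK ?andbT //=; case: (c == d).
Qed.

(* Between two pairs of non-adjacent vertices the edges form a 4-cycle, and a
   1-perfect orientation has to orient this cycle cyclically. *)
Lemma orientable_cocktail m :
  one_perfectly_orientable (compl (copies m (complete 2))).
Proof.
(* Going up in the index an arc keeps the second component, going down it flips it. Every vertex
   thus has exactly one out-neighbour in each other pair. *)
pose arc (u v : compl (copies m (complete 2))) :=
  (u.1 < v.1) && (u.2 == v.2) || (v.1 < u.1) && (u.2 != v.2).
exists arc; split; first split=> u v.
- rewrite edge_cocktail -val_eqE /arc.
  by case: ltngtP.
- rewrite edge_cocktail -val_eqE /arc [v.2 == _]eq_sym.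
  by case: ltngtP => //=; case: (u.2 == v.2).
move=> u v w; rewrite !inE => uv uw; rewrite edge_cocktail; apply: contra.
case: u v w uv uw => [i c] [j d] [k e]; rewrite /arc /= => uv uw /eqP eq_jk.
rewrite {}eq_jk in uv *.
case: ltngtP uv uw => //= _; rewrite ?orbF.
  by move=> /eqP<- /eqP<-.
rewrite xpair_eqE eqxx /=.
(* Two elements of ['I_2] that both differ from [c] coincide. *)
by case: c d e => [[|[|//]] ?] [[|[|//]] ?] [[|[|//]] ?].
Qed.

Lemma orientable_dunion (G1 G2 : sgraph) :
  one_perfectly_orientable G1 -> one_perfectly_orientable G2 ->
  one_perfectly_orientable (dunion G1 G2).
Proof.
move=> [arc1 [[E1 X1] C1]] [arc2 [[E2 X2] C2]].
exists (fun u v => match u, v with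
                   | inl x, inl y => arc1 x y
                   | inr x, inr y => arc2 x y
                   | _, _ => false
                   end).
split; first by split=> -[x|x] [y|y] //=; by [apply: E1|apply: E2|apply: X1|apply: X2].
move=> [v|v] [x|x] [y|y]; rewrite !inE //= => vx vy neq.
  by apply: (C1 v); rewrite ?inE.
by apply: (C2 v); rewrite ?inE.
Qed.

Lemma orientable_universal (G : sgraph) :
  one_perfectly_orientable G -> one_perfectly_orientable (add_universal G).
Proof.
move=> [arc [[arcE arcX] arcC]].
exists (fun u v => match u, v with
                   | Some x, Some y => arc x y
                   | Some _, None => true
                   | None, _ => false
                   end).
split; first by split=> -[x|] [y|] //=; [apply: arcE|apply: arcX].
move=> [v|] [x|] [y|]; rewrite !inE //= => vx vy neq.
by apply: (arcC v); rewrite ?inE.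
Qed.

Lemma orientable_twin (G : sgraph) (w : G) :
  one_perfectly_orientable G -> one_perfectly_orientable (add_true_twin w).
Proof.
move=> [arc [[arcE arcX] arcC]].
(* The edge between the twins is directed from [None] to [w], so the new vertex points to [w] and to
   all out-neighbours of [w]. *)
exists (fun u v => match u, v with
                   | Some x, Some y => arc x y
                   | Some x, None => arc x w
                   | None, Some y => (y == w) || arc w y
                   | None, None => false
                   end).
(* If [v] points to [w], it also points to the twin, so every out-neighbour of [v] has to be [w] or
   adjacent to it. *)
have clq v x : arc v x -> arc v w -> (x == w) || edge w x.
  move=> vx vw; case: eqVneq => //= neq.
  by apply: (arcC v); rewrite ?inE // eq_sym.
split; first split=> -[x|] [y|] //=.
- exact: arcE.
- by move/arcE; rewrite edge_sym orbC => ->.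
- by case/orP=> [->//|/arcE->]; rewrite orbT.
- exact: arcX.
- case: eqVneq => [-> _|_ /=]; last by rewrite edge_sym; apply: arcX.
  by case: (boolP (arc w w)) => // /arcE; rewrite edge_irrefl.
- case: eqVneq => [-> _|_ /=]; last by apply: arcX.
  by case: (boolP (arc w w)) => // /arcE; rewrite edge_irrefl.
move=> [v|] [x|] [y|]; rewrite !inE //=.
- by move=> vx vy neq; apply: (arcC v); rewrite ?inE.
- by move=> vx vw _; apply: clq vx vw.
- by move=> vw vy _; apply: clq vy vw.
- case/orP=> [/eqP->|wx]; case/orP=> [/eqP->|wy] neq //; first by rewrite eqxx in neq.
  + exact: arcE.
  + by rewrite edge_sym; apply: arcE.
  + by apply: (arcC w); rewrite ?inE.
Qed.

(** * The structure of K_{2,3}-free cographs *)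

Lemma embeds_dunionl (G1 G2 : sgraph) : embeds G1 (dunion G1 G2).
Proof. by exists inl => // x y []. Qed.

Lemma embeds_dunionr (G1 G2 : sgraph) : embeds G2 (dunion G1 G2).
Proof. by exists inr => // x y []. Qed.

Lemma embeds_joinl (G1 G2 : sgraph) : embeds G1 (join G1 G2).
Proof. by exists inl => // x y []. Qed.

Lemma embeds_joinr (G1 G2 : sgraph) : embeds G2 (join G1 G2).
Proof. by exists inr => // x y []. Qed.

Lemma giso_joinC (G1 G2 : sgraph) : giso (join G1 G2) (join G2 G1).
Proof.
pose swap (A B : Type) (u : A + B) : B + A :=
  match u with inl x => inr x | inr x => inl x end.
exists (@swap G1 G2) => [|[x|x] [y|y] //].
by exists (@swap G2 G1) => -[].
Qed.

Lemma giso_dunionC (G1 G2 : sgraph) : giso (dunion G1 G2) (dunion G2 G1).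
Proof.
pose swap (A B : Type) (u : A + B) : B + A :=
  match u with inl x => inr x | inr x => inl x end.
exists (@swap G1 G2) => [|[x|x] [y|y] //].
by exists (@swap G2 G1) => -[].
Qed.

Lemma giso_join (G1 G2 H1 H2 : sgraph) :
  giso G1 H1 -> giso G2 H2 -> giso (join G1 G2) (join H1 H2).
Proof.
move=> [f [f' fK f'K] fE] [g [g' gK g'K] gE].
exists (fun u : join G1 G2 => match u with inl x => inl (f x) | inr x => inr (g x) end).
  exists (fun u => match u with inl x => inl (f' x) | inr x => inr (g' x) end).
    by move=> [x|x]; rewrite ?fK ?gK.
  by move=> [x|x]; rewrite ?f'K ?g'K.
by move=> [x|x] [y|y]; [apply: fE| | |apply: gE].
Qed.

(** * Stable sets and graphs without universal vertices or true twins *)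

Definition stable (G : sgraph) (S : {set G}) : Prop :=
  {in S &, forall x y, ~~ edge x y}.

Definition stable_bound (G : sgraph) (n : nat) : Prop :=
  forall S : {set G}, stable S -> #|S| <= n.

Lemma stable_bound_embeds (G H : sgraph) n :
  embeds H G -> stable_bound G n -> stable_bound H n.
Proof.
move=> [f fI fE] boundG S stS; rewrite -(card_imset (mem S) fI); apply: boundG.
by move=> _ _ /imsetP[x Sx ->] /imsetP[y Sy ->]; rewrite fE stS.
Qed.

Lemma embeds_bipartite_join (G1 G2 : sgraph) (S1 : {set G1}) (S2 : {set G2}) m n :
  stable S1 -> stable S2 -> m <= #|S1| -> n <= #|S2| ->
  embeds (complete_bipartite m n) (join G1 G2).
Proof.
move=> st1 st2 le_m le_n.
exists (fun u : complete_bipartite m n => match u with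
  | inl i => inl (enum_val (widen_ord le_m i))
  | inr j => inr (enum_val (widen_ord le_n j))
  end).
  by move=> [i|i] [j|j] // [/enum_val_inj/(congr1 val)/= /val_inj->].
by move=> [i|i] [j|j] //=; apply: negbTE; [apply: st1|apply: st2]; apply: enum_valP.
Qed.

Section Reduced.
Variable G : sgraph.

(** Boolean, as is [true_twins], so that the existence of such vertices can be decided by cases. *)
Definition universal (u : G) : bool := [forall v, (v != u) ==> edge u v].

Definition true_twins (x y : G) : bool :=
  edge x y && [forall z, (z != x) && (z != y) ==> (edge x z == edge y z)].

(** In such a graph neither of the two vertex additions can have been the last construction step. *)
Definition reduced : Prop :=
  (forall u, ~~ universal u) /\ (forall x y, ~~ true_twins x y).
End Reduced.

Lemma universalP (G : sgraph) (u : G) :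
  reflect (forall v, v != u -> edge u v) (universal u).
Proof.
apply: (iffP forallP) => uE v; first by move/(implyP (uE v)).
exact/implyP/uE.
Qed.

Lemma true_twinsP (G : sgraph) (x y : G) :
  reflect (edge x y /\ forall z, z != x -> z != y -> edge x z = edge y z)
          (true_twins x y).
Proof.
apply: (iffP andP) => -[xy eqE]; split=> //.
  by move=> z zx zy; apply/eqP/(implyP (forallP eqE z)); rewrite zx.
by apply/forallP => z; apply/implyP => /andP[zx zy]; apply/eqP/eqE.
Qed.

Lemma reduced_giso (G H : sgraph) : giso G H -> reduced G -> reduced H.
Proof.
move=> /giso_sym[f fB fE] [nuni ntwin]; have fI := bij_inj fB.
have [g gK fK] := fB; split=> [u|x y].
  apply: contra (nuni (f u)) => /universalP uE; apply/universalP => v.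
  by rewrite -(fK v) (inj_eq fI) fE; apply: uE.
apply: contra (ntwin (f x) (f y)) => /true_twinsP[xy eqE]; apply/true_twinsP.
split=> [|z]; first by rewrite fE.
by rewrite -(fK z) !(inj_eq fI) !fE; apply: eqE.
Qed.

(** The vertices of [G2] are adjacent to all of [G1], so a universal vertex or a twin pair of [G1]
    would remain one in the join. *)
Lemma reduced_joinl (G1 G2 : sgraph) : reduced (join G1 G2) -> reduced G1.
Proof.
move=> [nuni ntwin]; split=> [u|x y].
  apply: contra (nuni (inl u)) => /universalP uE; apply/universalP => -[v|v] //.
  by move=> neq; apply: uE.
apply: contra (ntwin (inl x) (inl y)) => /true_twinsP[xy eqE]; apply/true_twinsP.
by split=> // -[z|z] //; apply: eqE.
Qed.

Lemma reduced_joinr (G1 G2 : sgraph) : reduced (join G1 G2) -> reduced G2.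
Proof. by move/(reduced_giso (giso_joinC _ _))/reduced_joinl. Qed.

Lemma stable_pair (G : sgraph) : reduced G -> 0 < #|G| ->
  exists2 S : {set G}, stable S & #|S| = 2.
Proof.
move=> [nuni _] /card_gt0P[u _]; have := nuni u.
rewrite negb_forall => /existsP[v]; rewrite negb_imply => /andP[neq uv].
exists [set u; v]; last by rewrite cards2 eq_sym neq.
by move=> x y; rewrite !inE => /orP[]/eqP-> /orP[]/eqP->;
  rewrite ?edge_irrefl // edge_sym.
Qed.

(** A stable triple in [G1] and a stable pair in [G2], which exists because [G2] has no universal
    vertex, would span a [K_{2,3}]. *)
Lemma stable_bound_joinl (G1 G2 : sgraph) :
  ~ embeds (complete_bipartite 2 3) (join G1 G2) ->
  reduced G2 -> 0 < #|G2| -> stable_bound G1 2.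
Proof.
move=> noK red2 G2_gt0 S stS; rewrite leqNgt; apply/negP => S_gt2; apply: noK.
have [T stT cardT] := stable_pair red2 G2_gt0.
apply: embeds_trans (giso_embeds (giso_joinC G2 G1)).
by apply: embeds_bipartite_join stT stS _ S_gt2; rewrite cardT.
Qed.

(** Distinct pairs are completely joined to each other, so a join only concatenates the two index
    ranges. *)
Lemma giso_join_cocktail m n :
  giso (join (compl (copies m (complete 2))) (compl (copies n (complete 2))))
       (compl (copies (m + n) (complete 2))).
Proof.
pose f (u : join (compl (copies m (complete 2))) (compl (copies n (complete 2)))) :
    compl (copies (m + n) (complete 2)) :=
  match u with inl x => (lshift n x.1, x.2) | inr x => (rshift m x.1, x.2) end.
apply: (@giso_card_leq _ _ f).
- move=> [[i c]|[i c]] [[j d]|[j d]] /= [].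
  + by move=> /val_inj-> ->.
  + by move=> eq_ij; have := ltn_ord i; rewrite eq_ij ltnNge leq_addr.
  + by move=> eq_ij; have := ltn_ord j; rewrite -eq_ij ltnNge leq_addr.
  + by move=> /addnI/val_inj-> ->.
- by rewrite card_sum !card_prod !card_ord mulnDl.
- move=> u v; rewrite edge_cocktail -val_eqE.
  case: u v => [x|x] [y|y].
  + exact: (esym (edge_cocktail x y)).
  + by rewrite neq_ltn (leq_trans (ltn_ord x.1)) ?leq_addr.
  + by rewrite neq_ltn (leq_trans (ltn_ord y.1)) ?leq_addr ?orbT.
  + by rewrite eqn_add2l; exact: (esym (edge_cocktail x y)).
Qed.

(* A disjoint union without independent triples has complete parts, and these
   are single vertices because there are no true twins. *)
Lemma reduced_cograph_cocktail (G : sgraph) :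
  cograph G -> stable_bound G 2 -> reduced G ->
  exists2 m, 0 < m & giso G (compl (copies m (complete 2))).
Proof.
elim=> {G} [G isoG|G G1 G2 c1 _ c2 _ isoG|G G1 G2 _ IH1 _ IH2 isoG] bound red.
(* The vertex of [K_1] is vacuously universal, so this case is contradictory. *)
- have [nuni _] := reduced_giso isoG red; case/negP: (nuni ord0).
  by apply/universalP => v; rewrite !ord1 eqxx.
- have single (K1 K2 : sgraph) : giso G (dunion K1 K2) -> 0 < #|K2| ->
      forall x y : K1, x = y.
    move=> isoK /card_gt0P[z _] x y; apply/eqP/negPn/negP => neq.
    have boundK := stable_bound_embeds (giso_embeds (giso_sym isoK)) bound.
    have complK a b : a != b :> K1 -> edge a b.
      move=> neq_ab; apply/negPn/negP => nab.
      have /boundK : stable [set (inl a : dunion K1 K2); inl b; inr z].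
        move=> s t; rewrite !inE -!orbA.
        by case/or3P=> /eqP-> /or3P[]/eqP-> //=;
          rewrite ?edge_irrefl // edge_sym.
      have neq_inl : inl a != inl b :> dunion K1 K2 by apply: neq_ab.
      by rewrite -setUA cardsU1 cards2 !inE (negbTE neq_inl).
    have [_ ntwin] := reduced_giso isoK red.
    case/negP: (ntwin (inl x) (inl y)); apply/true_twinsP; split=> [|[t|//]].
      exact: complK.
    by move=> tx ty; rewrite /= !complK // eq_sym; [apply: ty|apply: tx].
  have G1_gt0 := cograph_card_gt0 c1; have G2_gt0 := cograph_card_gt0 c2.
  have eq1 := single _ _ isoG G2_gt0.
  have eq2 := single _ _ (giso_trans isoG (giso_dunionC _ _)) G1_gt0.
  (* Two isolated vertices are the complement of a single edge, hence one pair. *)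
  exists 1 => //; apply: giso_trans isoG _.
  pose f (u : dunion G1 G2) : compl (copies 1 (complete 2)) :=
    (ord0, if u is inl _ then ord0 else ord_max).
  apply: (@giso_card_leq _ _ f).
  + move=> [x|x] [y|y] //= _; first by rewrite (eq1 x y).
    by rewrite (eq2 x y).
  + by rewrite card_sum card_prod !card_ord (leq_add G1_gt0 G2_gt0).
  + move=> u v; rewrite edge_cocktail eqxx.
    case: u v => [x|x] [y|y] //=; first by rewrite (eq1 x y) edge_irrefl.
    by rewrite (eq2 x y) edge_irrefl.
- have boundJ := stable_bound_embeds (giso_embeds (giso_sym isoG)) bound.
  have redJ := reduced_giso isoG red.
  have [m m_gt0 iso1] := IH1 (stable_bound_embeds (embeds_joinl _ _) boundJ)
                             (reduced_joinl redJ).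
  have [n n_gt0 iso2] := IH2 (stable_bound_embeds (embeds_joinr _ _) boundJ)
                             (reduced_joinr redJ).
  exists (m + n); first by rewrite addn_gt0 m_gt0.
  apply: giso_trans isoG (giso_trans (giso_join iso1 iso2) _).
  exact: giso_join_cocktail.
Qed.

(** * Undoing the two vertex additions *)

Section RemoveVertex.
Variables (G : sgraph) (u : G).

(** Puts [u] back in the place of [None]; the same bijection serves for universal vertices and for
    twins. *)
Definition restore (v : option (induced [set~ u])) : G :=
  if v is Some x then sval x else u.

Lemma restore_inj : injective restore.
Proof.
have neq (x : induced [set~ u]) : sval x != u by have := valP x; rewrite !inE.
move=> [x|] [y|] //= eq_xy; first by congr Some; apply: val_inj.
  by have := neq x; rewrite eq_xy eqxx.
by have := neq y; rewrite -eq_xy eqxx.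
Qed.

Lemma card_restore : #|G| <= #|{: option (induced [set~ u])}|.
Proof. by rewrite card_option card_induced cardsC1 leqSpred. Qed.

Lemma giso_remove_universal :
  universal u -> giso G (add_universal (induced [set~ u])).
Proof.
move=> /universalP uE; apply: giso_sym.
have uE' (x : induced [set~ u]) : edge u (sval x).
  by apply: uE; have := valP x; rewrite !inE.
apply: (@giso_card_leq (add_universal _) G _ restore_inj card_restore).
by move=> [x|] [y|] //=; rewrite ?edge_irrefl ?uE' // edge_sym uE'.
Qed.

Lemma giso_remove_twin (y : G) : true_twins u y ->
  exists w, giso G (@add_true_twin (induced [set~ u]) w).
Proof.
move=> /true_twinsP[uy eqE].
have inC : y \in [set~ u].
  by rewrite !inE; apply: contraTneq uy => ->; rewrite edge_irrefl.
(* The vertex to be doubled is the surviving twin [y]. *)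
exists (Sub y inC); apply: giso_sym.
have uE (x : induced [set~ u]) :
    edge u (sval x) = (x == Sub y inC) || edge (Sub y inC : induced [set~ u]) x.
  have := valP x; rewrite !inE -val_eqE /= /induced_edge /= => neq.
  by case: eqVneq => [->|neq_y] //=; apply: eqE.
apply: (@giso_card_leq (add_true_twin _) G _ restore_inj card_restore).
by move=> [x|] [z|] //=; rewrite ?edge_irrefl ?uE // edge_sym uE.
Qed.
End RemoveVertex.

(** * The recursive description and the equivalence *)

Definition constructible (P : sgraph -> Prop) (G : sgraph) : Prop :=
  giso G (complete 1)
  \/ (exists2 m : nat, 2 <= m & giso G (compl (copies m (complete 2))))
  \/ (exists G1 G2 : sgraph,
        [/\ cograph G1 /\ P G1, cograph G2 /\ P G2,
            #|G1| < #|G|, #|G2| < #|G| & giso G (dunion G1 G2)])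
  \/ (exists H : sgraph, [/\ cograph H, P H & giso G (add_universal H)])
  \/ (exists (H : sgraph) (w : H),
        [/\ cograph H, P H & giso G (add_true_twin w)]).

Lemma constructible_orientable (G : sgraph) :
  constructible one_perfectly_orientable G -> one_perfectly_orientable G.
Proof.
case=> [|[[m _]|[[G1 [G2 [[_ o1] [_ o2] _ _]]]|[[H [_ oH]]|[H [w [_ oH]]]]]]]
  /giso_embeds/orientable_embeds; apply.
- exact: orientable_K1.
- exact: orientable_cocktail.
- exact: orientable_dunion.
- exact: orientable_universal.
- exact: orientable_twin.
Qed.

(** [P] is left open and assumed only for smaller embedded cographs, so the decomposition can be
    used inside the induction that proves orientability and again for the final equivalence. *)
Lemma K23_free_constructible (P : sgraph -> Prop) (G : sgraph) :
  cograph G -> ~ embeds (complete_bipartite 2 3) G ->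
  (forall H, cograph H -> embeds H G -> #|H| < #|G| -> P H) ->
  constructible P G.
Proof.
move=> cG noK subP; have G_gt0 := cograph_card_gt0 cG.
have [G1|/negP G_neq1] := boolP (#|G| == 1).
  by left; apply: giso_card1 (eqP G1) (card_complete 1).
have G_gt1 : 1 < #|G| by rewrite ltn_neqAle eq_sym G_gt0 andbT; apply/negP.
(* Since [G] has at least two vertices, deleting one does not leave the null graph, which is no
   cograph. *)
have remove (u : G) : cograph (induced [set~ u]) /\ P (induced [set~ u]).
  have emb := embeds_induced [set~ u].
  have cardu : #|induced [set~ u]| = #|G|.-1 by rewrite card_induced cardsC1.
  have cu : cograph (induced [set~ u]).
    by apply: cograph_embeds cG emb _; rewrite cardu -ltnS prednK.
  by split=> //; apply: subP => //; rewrite cardu ltn_predL.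
have [[u uni]|/existsPn nuni] := altP (@existsP _ (@universal G)).
  have [cu Pu] := remove u; right; right; right; left.
  by exists (induced [set~ u]); split=> //; apply: giso_remove_universal.
have [[[x y] twin]|/existsPn ntwin] :=
  altP (@existsP _ (fun xy : G * G => true_twins xy.1 xy.2)).
  have [cx Px] := remove x; have [w isoG] := giso_remove_twin twin.
  by right; right; right; right; exists (induced [set~ x]), w.
have red : reduced G by split=> // x y; apply: (ntwin (x, y)).
case: cG noK subP red G_neq1 => {nuni ntwin remove G_gt0 G_gt1 G}
  [G /giso_card->|G G1 G2 c1 c2 isoG|G G1 G2 c1 c2 isoG] noK subP red G_neq1.
- by rewrite card_complete in G_neq1.
- have isoG' := giso_embeds (giso_sym isoG); right; right; left; exists G1, G2.
  have lt1 : #|G1| < #|G|.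
    by rewrite (giso_card isoG) card_sum -addn1 leq_add2l cograph_card_gt0.
  have lt2 : #|G2| < #|G|.
    by rewrite (giso_card isoG) card_sum -add1n leq_add2r cograph_card_gt0.
  split=> //; split=> //; apply: subP => //; apply: embeds_trans isoG'.
    exact: embeds_dunionl.
  exact: embeds_dunionr.
- have redJ := reduced_giso isoG red; right; left.
  have noKJ : ~ embeds (complete_bipartite 2 3) (join G1 G2).
    by move=> KJ; apply/noK/(embeds_trans KJ)/giso_embeds/giso_sym.
  have noKJ' : ~ embeds (complete_bipartite 2 3) (join G2 G1).
    by move=> KJ; apply/noKJ/(embeds_trans KJ)/giso_embeds/giso_joinC.
  have red1 := reduced_joinl redJ; have red2 := reduced_joinr redJ.
  have [m m_gt0 iso1] := reduced_cograph_cocktail c1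
    (stable_bound_joinl noKJ red2 (cograph_card_gt0 c2)) red1.
  have [n n_gt0 iso2] := reduced_cograph_cocktail c2
    (stable_bound_joinl noKJ' red1 (cograph_card_gt0 c1)) red2.
  (* Each side of the join contributes at least one pair, which gives the bound 2. *)
  exists (m + n); first by rewrite (leq_add m_gt0 n_gt0).
  apply: giso_trans isoG (giso_trans (giso_join iso1 iso2) _).
  exact: giso_join_cocktail.
Qed.

(** Strong induction on the number of vertices: the smaller embedded cographs are again
    [K_{2,3}]-free, and each clause of [constructible] preserves orientability. *)
Lemma K23_free_orientable (G : sgraph) :
  cograph G -> ~ embeds (complete_bipartite 2 3) G -> one_perfectly_orientable G.
Proof.
have [n] := ubnP #|G|; elim: n G => // n IHn G; rewrite ltnS => le_n cG noK.
apply: constructible_orientable; apply: K23_free_constructible => // H cH HG lt.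
apply: IHn => //; first exact: leq_trans le_n.
by move=> KH; apply/noK/(embeds_trans KH).
Qed.

Theorem theorem15 (G : sgraph) (cographG : cograph G) :
  (one_perfectly_orientable G <-> free_of (complete_bipartite 2 3) G) /\
  (free_of (complete_bipartite 2 3) G <->
     giso G (complete 1)
     \/ (exists2 m : nat, 2 <= m & giso G (compl (copies m (complete 2))))
     \/ (exists G1 G2 : sgraph,
           [/\ cograph G1 /\ one_perfectly_orientable G1,
               cograph G2 /\ one_perfectly_orientable G2,
               #|G1| < #|G|, #|G2| < #|G|
             & giso G (dunion G1 G2)])
     \/ (exists H : sgraph,
           [/\ cograph H, one_perfectly_orientable H & giso G (add_universal H)])
     \/ (exists (H : sgraph) (w : H),
           [/\ cograph H, one_perfectly_orientable H
             & giso G (add_true_twin w)])).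
Proof.
have orientable_free :
    one_perfectly_orientable G -> ~ embeds (complete_bipartite 2 3) G.
  by move=> oG KG; apply: K23_not_orientable (orientable_embeds KG oG).
split; split.
- by move/orientable_free/free_ofP.
- by move/free_ofP/(K23_free_orientable cographG).
- move=> /free_ofP noK; apply: K23_free_constructible => // H cH HG _.
  by apply: K23_free_orientable => // KH; apply/noK/(embeds_trans KH).
- by move/constructible_orientable/orientable_free/free_ofP.
Qed.
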